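(* Let $\alpha,\beta>0$ and $0<\delta<\beta$ be fixed constants, and let $n$ be sufficiently large. Let $a,b\in\mathbb{N}$ with $\ln^2 n\le a\le b\le n$, and $h,p\in\mathbb{R}$ with $1\le h\le n^{\delta}$ and $p\in(0,1]$, all be functions of $n$ which satisfy $aph\le\alpha\cdot\ln n$ and $bp>n^{\beta}$. Then there exists a constant $C=C(\alpha,\delta)\ge 1$, depending only on $\alpha$ and $\delta$, such that in $G(A,B,p)$, where $|A|=a$ and $|B|=b$, $$\mathbb{P}\left(\exists A'\subseteq A \text{ with } |A'|\le\frac{1}{ph} \text{ and a dominating set } D\subset B \text{ of } A\setminus A' \text{ with } |D|\le C\cdot\frac{\ln(eh)}{ph}\right)\ \ge\ 1-\exp\left[-\frac{n^{-\delta}\cdot b}{C}\right].$$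
   Context: For disjoint sets $A,B$ and $p\in[0,1]$, $G(A,B,p)$ is the random bipartite graph with parts $A$ and $B$ in which each edge with one endpoint in $A$ and the other in $B$ is included independently with probability $p$. For $S\subseteq A$, a set $D\subseteq B$ is a dominating set of $S$ if every vertex of $S$ has at least one neighbour in $D$. Here $e$ is the base of the natural logarithm. *)

(* Defs.v *)
From mathcomp Require Import all_boot all_order all_algebra.
From mathcomp Require Import reals sequences exp.

Set Implicit Arguments.
Unset Strict Implicit.
Unset Printing Implicit Defensive.

Import Order.TTheory GRing.Theory Num.Theory.

Local Open Scope ring_scope.

(* The parts are two finite types, hence disjoint as parts of the vertex set
   A + B; a bipartite graph is the set of pairs (u, v), u in A and v in B,
   that are joined by an edge. *)
Notation bigraph A B := {set A * B}.

Definition adjacent (A B : finType) (G : bigraph A B) (u : A) (v : B) : bool :=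
  (u, v) \in G.

Definition dominates (A B : finType) (G : bigraph A B) (D : {set B})
    (S : {set A}) : bool :=
  [forall u in S, exists v in D, adjacent G u v].

(* The law of G(A, B, p): independent edges, so the product of Bernoulli(p)
   weights over all potential edges. *)
Definition gnp_weight (R : realType) (A B : finType) (p : R)
    (G : bigraph A B) : R :=
  \prod_(e : A * B) (if e \in G then p else 1 - p).

Definition gnp_prob (R : realType) (A B : finType) (p : R)
    (Q : pred (bigraph A B)) : R :=
  \sum_(G : bigraph A B | Q G) gnp_weight p G.

(* Sanity check: any prescribed set of edges is present with probability
   p ^ (its size); S = set0 gives total mass 1. *)
Lemma gnp_prob_superset (R : realType) (A B : finType) (p : R)
    (S : bigraph A B) :
  gnp_prob p (fun G : bigraph A B => S \subset G) = p ^+ #|S|.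
Proof.
pose F (e : A * B) (c : bool) : R :=
  if c then p else if e \in S then 0 else 1 - p.
have -> : gnp_prob p (fun G : bigraph A B => S \subset G) =
    \sum_(G : bigraph A B) \prod_(e : A * B) F e (e \in G).
  rewrite /gnp_prob big_mkcond; apply: eq_bigr => G _.
  case: ifP => [/subsetP sSG | /negbT/subsetPn [e eS eG]].
    apply: eq_bigr => e _; rewrite /F; case: ifP => // eG.
    by case: ifP => // /sSG; rewrite eG.
  by rewrite (bigD1 e) //= /F (negbTE eG) eS mul0r.
rewrite (reindex (fun f : {ffun A * B -> bool} => [set e | f e])) /=; last first.
  exists (fun G : bigraph A B => [ffun e => e \in G]) => [f _ | G _].
    by apply/ffunP => e; rewrite ffunE inE.
  by apply/setP => e; rewrite inE ffunE.
under eq_bigr do under eq_bigr do rewrite inE.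
rewrite -(bigA_distr_bigA F) -prodr_const [RHS]big_mkcond; apply: eq_bigr => e _.
by rewrite big_bool /F /=; case: ifP => _; rewrite ?addr0 // addrC subrK.
Qed.

(* Main.v *)
Require Import Defs.
From mathcomp Require Import all_boot all_order all_algebra.
From mathcomp Require Import reals sequences exp.
From mathcomp Require Import ring lra zify.

Set Implicit Arguments.
Unset Strict Implicit.
Unset Printing Implicit Defensive.

Import Order.TTheory GRing.Theory Num.Theory.

Local Open Scope ring_scope.

(* Reveal the vertices of B one at a time and keep the set U of vertices of A that
   are not yet dominated. A new vertex v is put into D when it has at least k(|U|)
   neighbours in U, where k(u) ~ kappa ln n / ln (Z / u) with
   Z = K alpha ln n / p. Cutting U into k blocks shows that the degree of v into
   U reaches k with probability at least n^(-delta) / 3 as long as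
   |U| > 1 / (p h). Since Phi(u), the integral of 1 / k from 0 to u, drops by at
   least 1 with every chosen v, |D| <= Phi(a) = O (ln (e h) / (p h)), and
   exp (Phi |U|) is a supermartingale losing a factor 1 - n^(-delta) / 6 per
   vertex of B. *)

(** * Random subsets and lower bounds for binomial tails *)

Definition random_subset_weight (R : realType) (T : finType) (p : R)
    (N : {set T}) : R :=
  \prod_(x : T) (if x \in N then p else 1 - p).

Lemma random_subset_weight_ge0 (R : realType) (T : finType) (p : R)
    (N : {set T}) : 0 <= p <= 1 -> 0 <= random_subset_weight p N.
Proof.
move=> /andP[p0 p1]; apply: prodr_ge0 => x _.
by case: ifP => _ //; rewrite subr_ge0.
Qed.

Lemma sum_random_subset_weight (R : realType) (T : finType) (p : R) :
  \sum_(N : {set T}) random_subset_weight p N = 1.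
Proof.
rewrite -(@bigA_distr R 0 1 _ _ T (fun=> p) (fun=> 1 - p)) big1 // => x _.
by rewrite /= addrC subrK.
Qed.

(** Deciding afresh, with probability [p], whether [x] belongs to [N] does not change the law of
    [N]. This exposes one element at a time, as the recursion for the tail requires. *)
Lemma random_subset_resample (R : realType) (T : finType) (p : R) (x : T)
    (F : {set T} -> R) :
  \sum_N random_subset_weight p N * F N =
  \sum_N random_subset_weight p N * (p * F (x |: N) + (1 - p) * F (N :\ x)).
Proof.
pose W (N : {set T}) : R := \prod_(y | y != x) (if y \in N then p else 1 - p).
have split_x (H : {set T} -> R) :
    \sum_N random_subset_weight p N * H N =
    \sum_(N : {set T} | x \notin N) W N * (p * H (x |: N) + (1 - p) * H N).
  rewrite (bigID (fun N : {set T} => x \notin N)) /=.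
  (* The sets containing [x] are matched with those avoiding it, so both sides become sums over the
     latter. *)
  rewrite [X in _ + X](reindex_onto (fun N => x |: N) (fun N => N :\ x)) /=;
    last by move=> N; rewrite negbK => xN; rewrite setD1K.
  rewrite (eq_bigl (fun N : {set T} => x \notin N) (fun N => _ * H (x |: N)));
    last first.
    move=> N; rewrite setU11 /=; apply/eqP/idP => [<-|xN]; last by rewrite setU1K.
    by rewrite setD11.
  rewrite -big_split /=; apply: eq_bigr => N xN.
  rewrite /random_subset_weight (bigD1 x) //= (negbTE xN).
  rewrite [X in _ + X * _](bigD1 x) //= setU11 -/(W N).
  have -> : \prod_(i | i != x) (if i \in x |: N then p else 1 - p) = W N.
    by apply: eq_bigr => y /negbTE yx; rewrite in_setU1 yx.
  by ring.
rewrite !split_x; apply: eq_bigr => N xN.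
have NDx : N :\ x = N by apply/setDidPl; rewrite disjoint_sym disjoints1.
rewrite setUA setUid setU1K // NDx; ring.
Qed.

(** The probability that a binomial variable with parameters [u] and [p] is at least [k].
    Conditioning on the first trial avoids binomial coefficients and suits induction. *)
Fixpoint binomial_tail (R : realType) (p : R) (u k : nat) : R :=
  match u, k with
  | _, 0 => 1
  | 0, _.+1 => 0
  | u'.+1, k'.+1 => p * binomial_tail p u' k' + (1 - p) * binomial_tail p u' k
  end.

Lemma binomial_tail0 (R : realType) (p : R) (u : nat) : binomial_tail p u 0 = 1.
Proof. by case: u. Qed.

Lemma prob_inter_ge (R : realType) (T : finType) (p : R) (U : {set T}) (k : nat) :
  \sum_(N : {set T}) random_subset_weight p N * (k <= #|N :&: U|)%:R =
  binomial_tail p #|U| k.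
Proof.
elim: {U}#|U| {-2}U (erefl #|U|) k => [|u IH] U cardU [|k].
- rewrite binomial_tail0 -[RHS](sum_random_subset_weight T p).
  by apply: eq_bigr => N _; rewrite mulr1.
- move/eqP: cardU; rewrite cards_eq0 => /eqP ->.
  by rewrite cards0 big1 // => N _; rewrite setI0 cards0 mulr0.
- rewrite binomial_tail0 -[RHS](sum_random_subset_weight T p).
  by apply: eq_bigr => N _; rewrite mulr1.
have /card_gt0P[x xU] : (0 < #|U|)%N by rewrite cardU.
have cardUx : #|U :\ x| = u by move: cardU; rewrite (cardsD1 x) xU => -[].
rewrite (random_subset_resample p x) cardU /= -cardUx -!(IH _ cardUx) !mulr_sumr -big_split.
apply: eq_bigr => N _.
have -> : (x |: N) :&: U = x |: (N :&: (U :\ x)).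
  by apply/setP => y; rewrite !inE; case: eqVneq => // ->; rewrite xU.
have -> : (N :\ x) :&: U = N :&: (U :\ x).
  by apply/setP => y; rewrite !inE; case: eqVneq => //=; rewrite ?andbF.
rewrite cardsU1 !inE eqxx andbF add1n ltnS /=; ring.
Qed.

Lemma binomial_tailS_le (R : realType) (p : R) (u k : nat) :
  0 <= p <= 1 -> 0 <= binomial_tail p u k.+1 <= binomial_tail p u k.
Proof.
move=> /andP[p0 p1]; elim: u k => [|u IH] [|k] //=; rewrite ?lexx ?ler01 //.
  have /andP[] := IH 0%N; rewrite binomial_tail0 => ? ?.
  by apply/andP; split; nra.
have /andP[? ?] := IH k; have /andP[? ?] := IH k.+1.
by apply/andP; split; nra.
Qed.

Lemma binomial_tail_leS (R : realType) (p : R) (u k : nat) :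
  0 <= p <= 1 -> binomial_tail p u k <= binomial_tail p u.+1 k.
Proof.
move=> p01; case: k => [|k] /=; first by rewrite binomial_tail0.
by have /andP[? ?] := binomial_tailS_le u k p01; case/andP: p01 => ? ?; nra.
Qed.

Lemma binomial_tail_le_addl (R : realType) (p : R) (m u k : nat) :
  0 <= p <= 1 -> binomial_tail p u k <= binomial_tail p (m + u) k.
Proof.
move=> p01; elim: m => [|m IH] //; rewrite addSn.
exact: le_trans IH (binomial_tail_leS _ _ p01).
Qed.

(* Some success occurs among the first m trials, and k among the other u. *)
Lemma binomial_tail_block (R : realType) (p : R) (m u k : nat) : 0 <= p <= 1 ->
  (1 - (1 - p) ^+ m) * binomial_tail p u k <= binomial_tail p (m + u) k.+1.
Proof.
move=> p01; elim: m => [|m IH].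
  rewrite expr0 subrr mul0r add0n.
  by case/andP: (binomial_tailS_le u k p01).
rewrite addSn /= exprS.
have := binomial_tail_le_addl m u k p01.
by case/andP: p01 => ? ? ?; nra.
Qed.

Lemma binomial_tail_blocks (R : realType) (p : R) (m u k : nat) : 0 <= p <= 1 ->
  (k * m <= u)%N -> (1 - (1 - p) ^+ m) ^+ k <= binomial_tail p u k.
Proof.
move=> p01; elim: k u => [|k IH] u kmu; first by rewrite binomial_tail0 expr0.
have mu : (m <= u)%N by apply: leq_trans kmu; rewrite leq_pmull.
rewrite -(subnKC mu) exprS; apply: le_trans (binomial_tail_block _ _ _ p01).
apply: ler_wpM2l; last by apply: IH; rewrite leq_subRL // -mulSn.
case/andP: p01 => p0 p1; rewrite subr_ge0 exprn_ile1 ?subr_ge0 //; lra.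
Qed.

(** Follows from (1 - p)^m <= exp (- p m) <= 1 / (1 + p m). *)
Lemma one_sub_exp_ge (R : realType) (p : R) (m : nat) : 0 <= p <= 1 ->
  p * m%:R / (1 + p * m%:R) <= 1 - (1 - p) ^+ m.
Proof.
move=> /andP[p0 p1].
have x0 : 0 <= p * m%:R by rewrite mulr_ge0.
have h : (1 - p) ^+ m <= (1 + p * m%:R)^-1.
  apply: (@le_trans _ _ (expR (- (p * m%:R)))).
    rewrite -mulNr expRM_natr lerXn2r ?nnegrE ?expR_ge0 ?subr_ge0 //.
    exact: expR_ge1Dx.
  rewrite expRN lef_pV2 ?posrE ?expR_gt0 ?expR_ge1Dx //; lra.
have -> : p * m%:R / (1 + p * m%:R) = 1 - (1 + p * m%:R)^-1.
  by field; lra.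
lra.
Qed.

(* Cut the u trials into k blocks of u %/ k >= u / (2 k) trials each and ask for
   a success in every block. *)
Lemma binomial_tail_ge (R : realType) (p : R) (u k : nat) : 0 < p <= 1 ->
  (0 < k <= u)%N ->
  (1 + 2 * k%:R / (p * u%:R)) ^- k <= binomial_tail p u k.
Proof.
move=> /andP[p0 p1] /andP[k0 ku].
have p01 : 0 <= p <= 1 by rewrite ltW.
have m0 : (0 < u %/ k)%N by rewrite divn_gt0.
set m := (u %/ k)%N in m0.
(* Since m >= 1, u < (m + 1) k <= 2 k m: rounding the block length down costs at most a factor 2. *)
have um : u%:R <= 2 * k%:R * m%:R :> R.
  rewrite -!natrM ler_nat; have := ltn_ceil u k0; rewrite -/m => /ltnW h.
  by apply: leq_trans h _; rewrite mulnC -mulnA mulnCA leq_mul2l; apply/orP; right; lia.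
apply: (@le_trans _ _ ((1 - (1 - p) ^+ m) ^+ k)); last first.
  by apply: binomial_tail_blocks => //; rewrite mulnC leq_trunc_div.
have u0' : (0 < u%:R :> R) by rewrite ltr0n (leq_trans k0).
have k0' : (0 < k%:R :> R) by rewrite ltr0n.
have m0' : (0 < m%:R :> R) by rewrite ltr0n.
have pu0 : 0 < p * u%:R by rewrite mulr_gt0.
have pm0 : 0 < p * m%:R by rewrite mulr_gt0.
rewrite -exprVn lerXn2r ?nnegrE ?invr_ge0 //.
- by rewrite addr_ge0 // divr_ge0 ?mulr_ge0 // ltW.
- by rewrite subr_ge0 exprn_ile1 //; lra.
apply: le_trans (one_sub_exp_ge _ p01).
have -> : p * m%:R / (1 + p * m%:R) = (1 + (p * m%:R)^-1)^-1.
  by field; rewrite !gt_eqF //; lra.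
rewrite lef_pV2 ?posrE ?addr_gt0 ?divr_gt0 ?mulr_gt0 ?invr_gt0 // lerD2l.
rewrite ler_pdivlMr // mulrC ler_pdivrMr //.
by nra.
Qed.

(** * Revealing the graph one vertex of B at a time *)

Definition neighbours (A B : finType) (G : bigraph A B) (v : B) : {set A} :=
  [set u | Defs.adjacent G u v].

(** The edge weights, grouped by their endpoint in B, factor: the neighbourhoods of the vertices of
    B are independent random subsets of A. *)
Lemma sum_gnp_weight_neighbours (R : realType) (A B : finType) (p : R)
    (F : seq {set A} -> R) :
  \sum_(G : bigraph A B) gnp_weight p G * F (map (neighbours G) (enum B)) =
  \sum_(t : #|B|.-tuple {set A})
    (\prod_(N <- t) random_subset_weight p N) * F t.
Proof.
pose graph_of (t : #|B|.-tuple {set A}) : bigraph A B :=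
  [set e | e.1 \in tnth t (enum_rank e.2)].
have nbrE t v : neighbours (graph_of t) v = tnth t (enum_rank v).
  by apply/setP => u; rewrite !inE /Defs.adjacent inE.
rewrite (reindex graph_of) /=; last first.
  exists (fun G : bigraph A B => [tuple neighbours G (enum_val i) | i < #|B|]).
    by move=> t _; apply: eq_from_tnth => i; rewrite tnth_mktuple nbrE enum_valK.
  move=> G _; apply/setP => -[u v].
  by rewrite inE tnth_mktuple enum_rankK inE.
apply: eq_bigr => t _; congr (_ * F _); last first.
  rewrite (eq_map (nbrE t)); apply: (@eq_from_nth _ set0).
    by rewrite size_map -cardE size_tuple.
  move=> i; rewrite size_map -cardE => ltiB.
  pose v0 : B := enum_val (Ordinal ltiB).
  rewrite (nth_map v0) -?cardE // -[i in LHS]/(val (Ordinal ltiB)).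
  by rewrite -enum_val_nth enum_valK (tnth_nth set0).
  rewrite big_tuple (reindex enum_rank) /=; last exact/onW_bij/enum_rank_bij.
  under eq_bigr do rewrite -nbrE.
  rewrite /gnp_weight /random_subset_weight exchange_big /= pair_bigA; apply: eq_bigr => -[u v] _.
  by rewrite nbrE inE.
Qed.

(** Iterates a one-step supermartingale bound along independent draws. The induction conditions on
    the first draw, which [foldl] consumes first. *)
Lemma sum_tuple_foldl_le (R : realType) (T : finType) (S : Type) (w : T -> R)
    (step : S -> T -> S) (Psi : S -> R) (r : R) (n : nat) (s : S) :
  (forall x, 0 <= w x) -> 0 <= r ->
  (forall s, \sum_x w x * Psi (step s x) <= r * Psi s) ->
  \sum_(t : n.-tuple T) (\prod_(x <- t) w x) * Psi (foldl step s t) <=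
  r ^+ n * Psi s.
Proof.
move=> w0 r0 Psi_step; elim: n s => [|n IH] s.
  rewrite expr0 mul1r (bigD1 [tuple]) //= big_nil mul1r big1 ?addr0 //.
  by move=> t /eqP; case; exact: tuple0.
rewrite (reindex (fun xt : T * n.-tuple T => [tuple of xt.1 :: xt.2])) /=; last first.
  exists (fun t : n.+1.-tuple T => (thead t, [tuple of behead t])) => [[x t] _|t _].
    by rewrite theadE; congr (_, _); apply: val_inj.
  by rewrite [RHS]tuple_eta.
rewrite -(pair_bigA _ (fun x (t : n.-tuple T) =>
  (\prod_(y <- x :: t) w y) * Psi (foldl step (step s x) t))) /=.
apply: (@le_trans _ _ (\sum_x w x * (r ^+ n * Psi (step s x)))).
  apply: ler_sum => x _.
  under eq_bigr do rewrite big_cons -mulrA.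
  by rewrite -mulr_sumr ler_wpM2l.
under eq_bigr do rewrite mulrCA.
by rewrite -mulr_sumr exprSr -mulrA ler_wpM2l ?exprn_ge0.
Qed.

(** * The greedy process and its supermartingale *)

Definition greedy_step (R : realType) (A : finType) (thr : R) (k : nat -> nat)
    (U N : {set A}) : {set A} :=
  if (thr < #|U|%:R) && (k #|U| <= #|N :&: U|)%N then U :\: N else U.

(** A vertex may cover more than [k] elements, so the drop of [Phi] is assumed for every [u'] with
    [u' + k u <= u]. *)
Lemma greedy_potential (R : realType) (A : finType) (thr : R) (k : nat -> nat)
    (Phi : nat -> R) (U N : {set A}) :
  (forall u u', (u <= #|A|)%N -> thr < u%:R -> (u' + k u <= u)%N ->
     Phi u' + 1 <= Phi u) ->
  thr < #|U|%:R -> (k #|U| <= #|N :&: U|)%N ->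
  Phi #|U :\: N| + 1 <= Phi #|U|.
Proof.
move=> Phi_step thrU kU; apply: Phi_step => //; first exact: max_card.
by rewrite -[leqRHS](cardsID N U) addnC leq_add2r setIC.
Qed.

(** [D] collects the vertices that change the state. Each of them is paid for by a unit drop of
    [Phi], and [Phi] stays nonnegative. *)
Lemma greedy_foldl_dominates (R : realType) (A B : finType) (thr : R)
    (k : nat -> nat) (Phi : nat -> R) (nb : B -> {set A}) (vs : seq B)
    (U : {set A}) :
  (forall u, (u <= #|A|)%N -> 0 <= Phi u) ->
  (forall u u', (u <= #|A|)%N -> thr < u%:R -> (u' + k u <= u)%N ->
     Phi u' + 1 <= Phi u) ->
  exists2 D : {set B}, #|D|%:R <= Phi #|U| &
    forall x, x \in U -> x \notin foldl (greedy_step thr k) U (map nb vs) ->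
      exists2 v, v \in D & x \in nb v.
Proof.
move=> Phi0 Phi_step; elim: vs U => [|v vs IH] U /=.
  by exists set0; [rewrite cards0 Phi0 ?max_card | move=> x ->].
rewrite {2}/greedy_step; case: ifPn => [/andP[thrU kU]|_]; last exact: IH.
have [D cardD domD] := IH (U :\: nb v).
exists (v |: D).
  apply: le_trans (greedy_potential Phi_step thrU kU).
  apply: (@le_trans _ _ (#|D|%:R + 1)); last by rewrite lerD2r.
  by rewrite -[1]/(1%:R) -natrD ler_nat addn1 cardsU1 -add1n leq_add2r leq_b1.
move=> x xU xF; have [xv|xv] := boolP (x \in nb v).
  by exists v => //; rewrite setU11.
have [|v' v'D xv'] := domD x _ xF; first by rewrite inE xv.
by exists v' => //; rewrite in_setU v'D orbT.
Qed.

(* The supermartingale is exp (Phi u) while the number u of uncovered vertices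
   exceeds thr, and 0 afterwards: a useful vertex of B divides it by e >= 2. *)
Lemma greedy_domination_prob (R : realType) (A B : finType) (p q thr : R)
    (k : nat -> nat) (Phi : nat -> R) :
  0 <= p <= 1 -> 0 <= q <= 1 ->
  (forall u, (u <= #|A|)%N -> 0 <= Phi u) ->
  (forall u u', (u <= #|A|)%N -> thr < u%:R -> (u' + k u <= u)%N ->
     Phi u' + 1 <= Phi u) ->
  (forall u, (u <= #|A|)%N -> thr < u%:R -> q <= binomial_tail p u (k u)) ->
  1 - expR (Phi #|A| - q / 2 * #|B|%:R) <=
  gnp_prob p (fun G : bigraph A B =>
    [exists A' : {set A}, exists D : {set B},
      [&& #|A'|%:R <= thr, dominates G D (~: A') & #|D|%:R <= Phi #|A|]]).
Proof.
move=> p01 q01 Phi0 Phi_step tail.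
have q0 : 0 <= q by case/andP: q01.
set Q := (fun G : bigraph A B => _).
pose Psi (U : {set A}) : R := if thr < #|U|%:R then expR (Phi #|U|) else 0.
have Psi0 U : 0 <= Psi U by rewrite /Psi; case: ifP => // _; exact: expR_ge0.
have w0 (N : {set A}) := random_subset_weight_ge0 N p01.
have e2 : 2 <= expR 1 :> R by have := expR_ge1Dx (1 : R); lra.
(* With probability at least [q] the next vertex is useful and [Psi] is at least halved; otherwise
   [Psi] does not grow. *)
pose r : R := 1 - q / 2.
have Psi_step U : \sum_N random_subset_weight p N * Psi (greedy_step thr k U N) <=
    r * Psi U.
  have [thrU|thrU] := boolP (thr < #|U|%:R); last first.
    by rewrite big1 => [|N _]; rewrite /Psi /greedy_step (negbTE thrU) /= ?(negbTE thrU) ?mulr0.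
  apply: (@le_trans _ _ (\sum_N random_subset_weight p N *
      (expR (Phi #|U|) * (1 - (k #|U| <= #|N :&: U|)%:R / 2)))).
    apply: ler_sum => N _; apply: ler_wpM2l => //.
    rewrite /greedy_step thrU /=; case: ifPn => kU; last first.
      by rewrite /Psi thrU mul0r subr0 mulr1.
    apply: (@le_trans _ _ (expR (Phi #|U :\: N|))).
      by rewrite /Psi; case: ifP => // _; exact: expR_ge0.
    apply: (@le_trans _ _ (expR (Phi #|U| - 1))).
      by rewrite ler_expR lerBrDr (greedy_potential Phi_step).
    rewrite expRB ler_wpM2l ?expR_ge0 // mul1r.
    have -> : 1 - 2^-1 = 2^-1 :> R by field.
    by rewrite lef_pV2 ?posrE ?expR_gt0.
  have -> : \sum_N random_subset_weight p N *
      (expR (Phi #|U|) * (1 - (k #|U| <= #|N :&: U|)%:R / 2)) =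
      expR (Phi #|U|) * (1 - binomial_tail p #|U| (k #|U|) / 2).
    rewrite -prob_inter_ge -[X in _ * (X - _)](sum_random_subset_weight A p).
    rewrite mulr_suml -sumrB mulr_sumr; apply: eq_bigr => N _; ring.
  rewrite /Psi thrU mulrC ler_wpM2r ?expR_ge0 //.
  have := tail _ (max_card _) thrU; rewrite /r; lra.
have total : \sum_(G : bigraph A B) gnp_weight p G = 1.
  have := gnp_prob_superset p (set0 : bigraph A B); rewrite cards0 expr0 => <-.
  by apply: eq_bigl => G; rewrite sub0set.
(* If the final uncovered set [F] had size at most [thr], then [A' := F] would witness [Q]. So
   failure forces [Psi >= exp 0 = 1], and Markov's inequality applies. *)
have fail_le (G : bigraph A B) : ~~ Q G ->
    1 <= Psi (foldl (greedy_step thr k) setT (map (neighbours G) (enum B))).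
  set F := foldl _ _ _ => nQ; rewrite /Psi; case: ltP => [_|Fthr].
    by rewrite -expR0 ler_expR Phi0 ?max_card.
  case/negP: nQ; apply/existsP; exists F.
  have [D cardD domD] := greedy_foldl_dominates (neighbours G) (enum B) setT Phi0 Phi_step.
  apply/existsP; exists D; rewrite Fthr /=; apply/andP; split; last by rewrite -cardsT.
  apply/forallP => x; apply/implyP; rewrite inE => xF.
  have [|v vD xv] := domD x _ xF; first by rewrite inE.
  by apply/existsP; exists v; rewrite vD /=; move: xv; rewrite inE.
have W0 (G : bigraph A B) : 0 <= gnp_weight p G.
  exact: (random_subset_weight_ge0 G p01).
have := total; rewrite (bigID Q) /= -/(gnp_prob p Q) => total'.
rewrite -[X in X - _]total' lerBlDr lerD2l.
apply: (@le_trans _ _ (\sum_(G : bigraph A B) gnp_weight p G *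
    Psi (foldl (greedy_step thr k) setT (map (neighbours G) (enum B))))).
  rewrite [leLHS]big_mkcond /=; apply: ler_sum => G _; case: ifPn => nQ.
    by rewrite ler_peMr // fail_le.
  by rewrite mulr_ge0.
rewrite (sum_gnp_weight_neighbours B p (fun t => Psi (foldl (greedy_step thr k) setT t))).
have r0 : 0 <= r by rewrite /r; case/andP: q01 => ? ?; lra.
apply: le_trans (sum_tuple_foldl_le _ _ w0 r0 Psi_step) _.
rewrite [Phi _ - _]addrC expRD; apply: ler_pM; rewrite ?exprn_ge0 ?Psi0 //; last first.
  rewrite /Psi; case: ifP => _; first by rewrite cardsT.
  exact: expR_ge0.
rewrite -mulNr expRM_natr lerXn2r ?nnegrE ?expR_ge0 //.
by have := expR_ge1Dx (- (q / 2)); rewrite /r; lra.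
Qed.

(** * The potential and the degree required of a chosen vertex *)

(** The function x (ln (Z / x) + 1) is concave with derivative ln (Z / x), so it lies below its
    tangent at [x]. For y > 0 this amounts to 1 + ln (x / y) <= x / y. *)
Lemma mulr_ln_div_tangent (R : realType) (Z x y : R) : 0 < Z -> 0 < x -> 0 <= y ->
  (x - y) * ln (Z / x) <= x * (ln (Z / x) + 1) - y * (ln (Z / y) + 1).
Proof.
move=> Z0 x0; rewrite le_eqVlt => /predU1P[<-|y0].
  by rewrite mul0r !subr0; nra.
have := expR_ge1Dx (ln (x / y)).
rewrite lnK ?posrE ?divr_gt0 // !ln_div ?posrE // ler_pdivlMr //; nra.
Qed.

(* cover_potential Z c is the integral from 0 to u of ln (Z / x) / c, the
   reciprocal of the gain before rounding. *)
Definition cover_potential (R : realType) (Z c : R) (u : nat) : R :=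
  u%:R * (ln (Z / u%:R) + 1) / c.

(** Truncation plus one exceeds c / ln (Z / u), so rounding favours the unit drop of the potential,
    and the gain is never 0. *)
Definition cover_gain (R : realType) (Z c : R) (u : nat) : nat :=
  (Num.trunc (c / ln (Z / u%:R))).+1.

(** By the tangent inequality at [u], the drop is at least (u - u') ln (Z / u) / c, and u - u' is at
    least the gain. *)
Lemma cover_potential_step (R : realType) (Z c : R) (u u' : nat) :
  0 < Z -> 0 < c -> (0 < u)%N -> 0 < ln (Z / u%:R) ->
  (u' + cover_gain Z c u <= u)%N ->
  cover_potential Z c u' + 1 <= cover_potential Z c u.
Proof.
move=> Z0 c0 u0 l0 gain; rewrite /cover_potential -lerBrDl -mulrBl ler_pdivlMr // mul1r.
have u0' : 0 < u%:R :> R by rewrite ltr0n.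
apply: le_trans (mulr_ln_div_tangent Z0 u0' (ler0n R u')).
rewrite -ler_pdivrMr //; apply: le_trans (ltW (truncnS_gt _)) _.
by rewrite lerBrDl -natrD ler_nat.
Qed.

Lemma cover_gain_tail (R : realType) (p q h Z c : R) (u : nat) :
  0 < p <= 1 -> 0 < c -> 1 <= h -> (0 < u)%N -> 1 <= p * u%:R * h ->
  1 <= ln (Z / u%:R) -> 0 < Z -> 2 * c <= u%:R ->
  1 + 4 * c / (p * u%:R) <= Z / u%:R ->
  q <= (3 * h)^-1 -> q <= expR (- (2 * c)) ->
  q <= binomial_tail p u (cover_gain Z c u).
Proof.
move=> /andP[p0 p1] c0 h1 u0 puh l1 Z0 cu bigZ qh qc.
have u0' : 0 < u%:R :> R by rewrite ltr0n.
have pu0 : 0 < p * u%:R by rewrite mulr_gt0.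
have l0 : 0 < ln (Z / u%:R) by lra.
have p01 : 0 < p <= 1 by rewrite p0.
(* If c / ln (Z / u) < 1, a single neighbour suffices, and the tail is at least 1 / (1 + 2 / (p u))
   >= 1 / (1 + 2 h) >= 1 / (3 h). *)
have [cl|cl] := leP 1 (c / ln (Z / u%:R)); last first.
  have -> : cover_gain Z c u = 1%N.
    by rewrite /cover_gain; congr S; apply/truncn0Pn; rewrite -ltNge.
  apply: le_trans (binomial_tail_ge p01 _); rewrite ?u0 //.
  apply: le_trans qh _; rewrite expr1 lef_pV2 ?posrE ?addr_gt0 ?divr_gt0 ?mulr_gt0 //; last lra.
  suff : 2 * 1 / (p * u%:R) <= 2 * h by lra.
  by rewrite ler_pdivrMr //; lra.
have := cl; rewrite ler_pdivlMr // mul1r => lc.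
set k := cover_gain Z c u.
(* Otherwise rounding at most doubles the gain. The base 1 + 2 k / (p u) is at most Z / u, whose
   k-th power is exp (k ln (Z / u)) <= exp (2 c). *)
have k2 : k%:R * ln (Z / u%:R) <= 2 * c.
  rewrite -ler_pdivlMr // /k /cover_gain -natr1.
  have := truncn_le (c / ln (Z / u%:R)); rewrite (le_trans ler01 cl) -mulrA; lra.
have k0 : 0 <= k%:R :> R by [].
have kc : k%:R <= 2 * c by nra.
apply: le_trans (binomial_tail_ge p01 _); last first.
  by rewrite /= -(ler_nat R); apply: le_trans kc cu.
apply: le_trans qc _; rewrite expRN lef_pV2 ?posrE ?expR_gt0 ?exprn_gt0 ?addr_gt0 //; last first.
  by rewrite divr_gt0 // mulr_gt0 // ltr0n.
apply: (@le_trans _ _ (expR (k%:R * ln (Z / u%:R)))); last by rewrite ler_expR.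
rewrite expRM_natl lnK ?posrE ?divr_gt0 //.
have base0 : 0 <= 2 * k%:R / (p * u%:R) by rewrite divr_ge0 ?mulr_ge0 // ltW.
rewrite lerXn2r ?nnegrE ?addr_ge0 ?(ltW (divr_gt0 Z0 u0')) //.
apply: le_trans bigZ; rewrite lerD2l ler_pM2r ?invr_gt0 //; lra.
Qed.

(** * Choice of the constants and verification of the estimates *)

Theorem theorem4p2 (R : realType) (alpha delta : R)
    (alpha_gt0 : 0 < alpha) (delta_gt0 : 0 < delta) :
  exists C : R, 1 <= C /\
    forall beta : R, 0 < beta -> delta < beta ->
    exists n0 : nat, forall n : nat, (n0 <= n)%N ->
    forall (a b : nat) (h p : R),
      (ln (n%:R : R)) ^+ 2 <= a%:R -> (a <= b)%N -> (b <= n)%N ->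
      1 <= h -> h <= (n%:R : R) `^ delta ->
      0 < p -> p <= 1 ->
      a%:R * p * h <= alpha * ln (n%:R : R) ->
      (n%:R : R) `^ beta < b%:R * p ->
    forall A B : finType, #|A| = a -> #|B| = b ->
      1 - expR (- ((n%:R : R) `^ (- delta) * b%:R / C))
      <= gnp_prob p (fun G : bigraph A B =>
           [exists A' : {set A}, exists D : {set B},
             [&& #|A'|%:R <= 1 / (p * h),
                 dominates G D (~: A')
               & #|D|%:R <= C * (ln (expR 1 * h) / (p * h))]]).
Proof.
pose kappa := delta / (2 * (1 + alpha * delta)).
have ad0 : 0 < alpha * delta by rewrite mulr_gt0.
(* [kappa] is small enough for two purposes: 2 kappa <= delta gives exp (- 2 c) >= n^(-delta), and 2
   kappa alpha <= 1 gives 2 c <= u above the threshold. *)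
have kappa0 : 0 < kappa by rewrite divr_gt0 // mulr_gt0 //; lra.
have kappa_delta : 2 * kappa <= delta.
  have -> : 2 * kappa = delta / (1 + alpha * delta).
    by rewrite /kappa; field; rewrite gt_eqF //; lra.
  rewrite ler_pdivrMr; nra.
have kappa_alpha : 2 * kappa * alpha <= 1.
  have -> : 2 * kappa * alpha = alpha * delta / (1 + alpha * delta).
    by rewrite /kappa; field; rewrite gt_eqF //; lra.
  rewrite ler_pdivrMr; lra.
(* The summand e makes ln (Z / u) >= 1; the remaining summands give 1 + 4 c / (p u) <= Z / u. *)
pose K := expR 1 + 1 + 4 * kappa / alpha.
have ka0 : 0 < 4 * kappa / alpha by rewrite divr_gt0 // mulr_gt0.
have e0 := expR_gt0 (1 : R).
have K1 : 1 <= K by rewrite /K; lra.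
have lnK0 := ln_ge0 K1.
pose C1 := alpha * (ln K + 1) / kappa.
have C10 : 0 < C1 by rewrite divr_gt0 // mulr_gt0 //; lra.
(* [C1] bounds the size of [D]. The 12 is for the exponent: of the rate q / 2 = n^(-delta) / 6, half
   is spent on absorbing [Phi a]. *)
exists (12 + C1); split; first lra.
move=> beta beta0 delta_beta.
have bd0 : 0 < beta - delta by lra.
(* ln n >= M ensures both ln n >= 1 and 12 C1 <= n^(beta - delta). *)
pose M := 1 + 12 * C1 / (beta - delta).
exists (Num.trunc (expR M)).+1 => n n0n a b h p La ab bn h1 hn p0 p1 aph bp A B cardA cardB.
have Mn : expR M <= n%:R.
  by apply: le_trans (ltW (truncnS_gt _)) _; rewrite ler_nat.
have n0 : 0 < n%:R :> R := lt_le_trans (expR_gt0 M) Mn.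
have powE x : n%:R `^ x = expR (x * ln n%:R) :> R by rewrite /powR gt_eqF.
rewrite !powE mulNr in hn bp *.
set L := ln n%:R in La hn aph bp powE *.
have ML : M <= L by rewrite -[M]expRK ler_ln ?posrE ?expR_gt0.
have CM0 : 0 < 12 * C1 / (beta - delta) by rewrite divr_gt0 // mulr_gt0.
have L1 : 1 <= L by rewrite /M in ML; lra.
have L0 : 0 < L by lra.
have h0 : 0 < h by lra.
have ph0 : 0 < p * h by rewrite mulr_gt0.
have aL0 : 0 < alpha * L by rewrite mulr_gt0.
pose c := kappa * L.
have c0 : 0 < c by rewrite mulr_gt0.
pose Z := K * (alpha * L) / p.
have Z0 : 0 < Z by rewrite divr_gt0 // mulr_gt0 //; lra.
have upos u : (0 < u)%N -> 0 < u%:R :> R by rewrite ltr0n.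
have uph u : (u <= a)%N -> u%:R * p * h <= alpha * L.
  move=> ua; apply: le_trans aph; rewrite -!mulrA ler_wpM2r ?ler_nat //.
  exact: ltW.
have ZE u : (0 < u)%N -> Z / u%:R = K * (alpha * L / (p * u%:R)).
  by move=> /upos u0; rewrite /Z; field; rewrite !gt_eqF.
have hZ u : (0 < u)%N -> (u <= a)%N -> h <= alpha * L / (p * u%:R).
  move=> u0 /uph; have := upos _ u0 => u0'.
  by rewrite ler_pdivlMr ?mulr_gt0 //; lra.
have lnZ u : (0 < u)%N -> (u <= a)%N -> 1 <= ln (Z / u%:R).
  move=> u0 ua; have := hZ _ u0 ua => ?.
  rewrite -[leLHS]expRK ler_ln ?posrE ?e0 ?(divr_gt0 Z0 (upos _ u0)) // ZE //.
  by apply: (@le_trans _ _ K); [rewrite /K; lra | rewrite ler_peMr; lra].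
have thr_pos u : 1 / (p * h) < u%:R -> (0 < u)%N /\ 1 < p * u%:R * h.
  rewrite ltr_pdivrMr // => puh; split; last lra.
  by rewrite lt0n; apply: contraTneq puh => ->; rewrite mul0r -leNgt.
(* From 1 < p u h, L^2 <= a < a p h u <= alpha L u, hence L < alpha u; this is where ln^2 n <= a
   enters. *)
have Lu u : 1 / (p * h) < u%:R -> 2 * c <= u%:R.
  move=> /thr_pos[u0]; have := upos _ u0 => u0' puh.
  have La' : L * L <= a%:R by rewrite -expr2.
  have : L * L < L * (alpha * u%:R).
    apply: (le_lt_trans La'); apply: (@lt_le_trans _ _ (a%:R * (p * u%:R * h))).
      rewrite ltr_pMr //; by apply: (lt_le_trans _ La'); rewrite mulr_gt0.
    by have := ler_wpM2r (ltW u0') aph; lra.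
  rewrite ltr_pM2l // /c => Lau.
  have : kappa * L <= kappa * (alpha * u%:R) by rewrite ler_wpM2l // ltW.
  have : 2 * kappa * alpha * u%:R <= 1 * u%:R by rewrite ler_wpM2r // ltW.
  lra.
pose Phi := cover_potential Z c.
have Phi0 u : (u <= #|A|)%N -> 0 <= Phi u.
  rewrite cardA => ua; rewrite /Phi /cover_potential.
  have [->|u0] := posnP u; first by rewrite !mul0r.
  have := lnZ _ u0 ua => ?.
  by rewrite divr_ge0 ?(ltW c0) // mulr_ge0 //; lra.
have Phi_step u u' : (u <= #|A|)%N -> 1 / (p * h) < u%:R ->
    (u' + cover_gain Z c u <= u)%N -> Phi u' + 1 <= Phi u.
  rewrite cardA => ua /thr_pos[u0 _]; apply: cover_potential_step => //.
  exact: lt_le_trans ltr01 (lnZ _ u0 ua).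
(* The factor 1 / 3 matches the bound 1 / (3 h), as h <= n^delta. *)
pose q := expR (- (delta * L)) / 3.
have q01 : 0 <= q <= 1.
  rewrite divr_ge0 ?expR_ge0 //=.
  have : expR (- (delta * L)) <= 1 by rewrite expR_le1 oppr_le0 mulr_ge0 // ltW.
  by rewrite /q; lra.
have tail u : (u <= #|A|)%N -> 1 / (p * h) < u%:R ->
    q <= binomial_tail p u (cover_gain Z c u).
  rewrite cardA => ua thr_u; have [u0 puh] := thr_pos _ thr_u.
  have u0' := upos _ u0.
  have pu0 : 0 < p * u%:R by rewrite mulr_gt0.
  apply: (@cover_gain_tail _ _ _ h) => //; rewrite ?p0 ?lnZ ?Lu ?(ltW puh) //.
  - rewrite ZE //; have := hZ _ u0 ua; set y := alpha * L / _ => hy.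
    have -> : 4 * c / (p * u%:R) = 4 * kappa / alpha * y.
      by rewrite /y /c; field; rewrite !gt_eqF.
    by rewrite /K; nra.
  - rewrite /q invfM mulrC ler_pM2l ?invr_gt0 // expRN lef_pV2 ?posrE ?expR_gt0 //.
  - apply: (@le_trans _ _ (expR (- (delta * L)))).
      by rewrite /q; have := expR_gt0 (- (delta * L)); lra.
    by rewrite ler_expR lerN2 /c mulrA ler_wpM2r // ltW.
have lneh : ln (expR 1 * h) = 1 + ln h by rewrite lnM ?posrE // expRK.
have lnh0 := ln_ge0 h1.
have lneh_le : ln (expR 1 * h) <= h.
  by rewrite lneh; have := expR_ge1Dx (ln h); rewrite lnK ?posrE.
have Phi_a : Phi a <= C1 * (ln (expR 1 * h) / (p * h)).
  (* [T] is the largest value of [a] allowed by a p h <= alpha L. The tangent at [T], where Z / T =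
     K h, bounds the potential at [a] without a lower bound on a p h. *)
  pose T := alpha * L / (p * h).
  have T0 : 0 < T by rewrite divr_gt0.
  have aT : a%:R <= T by rewrite ler_pdivlMr // mulrA.
  have ZT : Z / T = K * h by rewrite /Z /T; field; rewrite !gt_eqF.
  have lnKh : ln (K * h) = ln K + ln h by rewrite lnM ?posrE //; lra.
  have := mulr_ln_div_tangent Z0 T0 (ler0n R a); rewrite ZT lnKh => tangent.
  have ga : a%:R * (ln (Z / a%:R) + 1) <= T * (ln K + ln h + 1).
    have : 0 <= (T - a%:R) * (ln K + ln h) by rewrite mulr_ge0 //; lra.
    lra.
  have -> : C1 * (ln (expR 1 * h) / (p * h)) =
      T * ((ln K + 1) * ln (expR 1 * h)) / c.
    by rewrite /C1 /T /c; field; rewrite !gt_eqF.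
  rewrite ler_wpM2r ?invr_ge0 ?(ltW c0) //; apply: le_trans ga _.
  rewrite ler_wpM2l ?(ltW T0) // lneh; nra.
(* As ln (e h) <= h, [Phi a] is at most C1 / p, which b p > n^beta makes small against n^(-delta)
   b. *)
have Phi_b : Phi a <= expR (- (delta * L)) * b%:R / 12.
  apply: le_trans Phi_a _.
  apply: (@le_trans _ _ (C1 / p)).
    rewrite ler_wpM2l ?(ltW C10) // ler_pdivrMr // mulrA mulVf ?gt_eqF // mul1r //.
  rewrite ler_pdivrMr //.
  have C1bd : 12 * C1 <= expR ((beta - delta) * L).
    apply: le_trans (expR_ge1Dx _).
    have : 12 * C1 / (beta - delta) <= L by rewrite /M in ML; lra.
    rewrite ler_pdivrMr //; lra.
  have : expR (- (delta * L)) * expR (beta * L) <= expR (- (delta * L)) * (b%:R * p).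
    by rewrite ler_wpM2l ?expR_ge0 // ltW.
  rewrite -expRD (_ : - (delta * L) + beta * L = (beta - delta) * L); last by ring.
  lra.
have p01 : 0 <= p <= 1 by rewrite ltW.
have := greedy_domination_prob B p01 q01 Phi0 Phi_step tail.
rewrite cardA cardB => main.
have E0 : 0 <= expR (- (delta * L)) * b%:R by rewrite mulr_ge0 ?expR_ge0.
apply: (le_trans (le_trans _ main)).
  rewrite lerD2l lerN2 ler_expR.
  have : expR (- (delta * L)) * b%:R / (12 + C1) <= expR (- (delta * L)) * b%:R / 12.
    by rewrite ler_wpM2l // lef_pV2 ?posrE //; lra.
  by move: Phi_b; rewrite /q; lra.
(* The event only grows when the bound [Phi a] on the size of [D] is relaxed to the stated one. *)
rewrite /gnp_prob [leLHS]big_mkcond [leRHS]big_mkcond /=; apply: ler_sum => G _.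
case: ifP => [/existsP[A' /existsP[D /and3P[cA' domD cD]]]|_].
  rewrite ifT //; apply/existsP; exists A'; apply/existsP; exists D.
  rewrite cA' domD /=; apply: le_trans cD _; apply: le_trans Phi_a _.
  by rewrite ler_wpM2r ?divr_ge0 ?(ltW ph0) ?lneh //; lra.
by case: ifP => // _; exact: (random_subset_weight_ge0 G p01).
Qed.
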